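(* Let $Q$ be a medial quandle. Then the following statements are equivalent: (1) $Q$ is reductive; (2) at least one orbit of $Q$ is reductive; (3) all orbits of $Q$ are reductive. Moreover, for every integer $m\ge 1$: (a) $Q$ is $m$-reductive if and only if all orbits of $Q$ are $(m-1)$-reductive; (b) if one orbit of $Q$ is $m$-reductive, then $Q$ is $(m+3)$-reductive.
   Context: A quandle is a non-empty set $Q$ with a binary operation such that for all $x,y,z$: $xx=x$; $x(yz)=(xy)(xz)$; and $xu=y$ has a unique solution $u\in Q$. It is medial if $(xy)(uv)=(xu)(yv)$ for all $x,y,u,v\in Q$. The left translation by $a$ is $L_a(x)=ax$; $\mathrm{LMlt}(Q)$ is the permutation group generated by all $L_a$, $a\in Q$. The orbits of $Q$ are the orbits of the action of $\mathrm{LMlt}(Q)$ on $Q$; each orbit is a subquandle of $Q$ and is regarded as a quandle. A binary algebra is $m$-reductive if $(R_y)^m(x)=y$ for all $x,y$, where $R_y(x)=xy$; i.e., $(((xy)y)\cdots)y=y$ with $m$ multiplications by $y$ on the right (for $m=0$, where $(R_y)^0$ is the identity map, this says $x=y$ for all $x,y$). It is reductive if it is $m$-reductive for some $m$. *)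

(* Defs.v *)
From HB Require Import structures.
From mathcomp Require Import all_boot.
From mathcomp Require Import boolp.

Set Implicit Arguments.
Unset Strict Implicit.
Unset Printing Implicit Defensive.

(* [right_distributive op op] unfolds to x(yz) = (xy)(xz). *)
HB.mixin Record isQuandle (T : Type) := {
  qop : T -> T -> T;
  quandle_inhabited : inhabited T;
  qopxx : idempotent_op qop;
  qopDr : right_distributive qop qop;
  qop_unique : forall x y : T, exists! u : T, qop x u = y
}.

#[short(type="quandleType")]
HB.structure Definition Quandle := { T of isQuandle T }.

Declare Scope quandle_scope.
Delimit Scope quandle_scope with Qd.
Local Open Scope quandle_scope.
Notation "x * y" := (qop x y) : quandle_scope.

Definition ltrans (Q : quandleType) (a x : Q) : Q := a * x.
Definition rtrans (Q : quandleType) (y x : Q) : Q := x * y.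

(* [interchange op op] unfolds to (xy)(zt) = (xz)(yt). *)
Definition medial (Q : quandleType) : Prop := interchange (@qop Q) (@qop Q).

Inductive LMlt (Q : quandleType) : (Q -> Q) -> Prop :=
| LMlt_id : LMlt id
| LMlt_ltrans a : LMlt (ltrans a)
| LMlt_comp f g : LMlt f -> LMlt g -> LMlt (f \o g)
| LMlt_inv f g : LMlt f -> cancel f g -> cancel g f -> LMlt g.

Definition in_orbit (Q : quandleType) (e x : Q) : Prop :=
  exists2 f : Q -> Q, LMlt f & f e = x.

Definition m_reductive (Q : quandleType) (m : nat) : Prop :=
  forall x y : Q, iter m (rtrans y) x = y.

Definition reductive (Q : quandleType) : Prop := exists m, m_reductive Q m.

Definition qorbit (Q : quandleType) (e : Q) : Type := {x : Q | in_orbit e x}.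

Section OrbitQuandle.
Variables (Q : quandleType) (e : Q).

Lemma orbit_inj (x y : qorbit e) : sval x = sval y -> x = y.
Proof.
case: x y => [x px] [y py] /= exy; move: px; rewrite exy => px.
by rewrite (Prop_irrelevance px py).
Qed.

Lemma in_orbit_refl : in_orbit e e.
Proof. by exists id => //; apply: LMlt_id. Qed.

Lemma in_orbit_mul (x y : Q) : in_orbit e y -> in_orbit e (x * y).
Proof.
case=> f Lf <-; exists (ltrans x \o f) => //.
by apply: LMlt_comp => //; apply: LMlt_ltrans.
Qed.

Lemma in_orbit_div (x u : Q) : in_orbit e (x * u) -> in_orbit e u.
Proof.
have [g gP] : exists g : Q -> Q, forall y, x * g y = y.
  have [|g gP] := @choice Q Q (fun y v => x * v = y); last by exists g.
  by move=> y; have [v [xv _]] := qop_unique x y; exists v.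
have gK : cancel (ltrans x) g.
  move=> v; have [w [_ w_uniq]] := qop_unique x (x * v).
  by rewrite -[RHS](w_uniq v) // -(w_uniq (g (ltrans x v))) // gP.
case=> f Lf fe; exists (g \o f); last by rewrite /= fe gK.
apply: LMlt_comp => //; exact: LMlt_inv (LMlt_ltrans x) gK gP.
Qed.

Definition orbit_qop (x y : qorbit e) : qorbit e :=
  exist _ (sval x * sval y) (in_orbit_mul (sval x) (svalP y)).

Lemma orbit_inhabited : inhabited (qorbit e).
Proof. by split; exists e; apply: in_orbit_refl. Qed.

Lemma orbit_qopxx : idempotent_op orbit_qop.
Proof. by move=> x; apply: orbit_inj; apply: qopxx. Qed.

Lemma orbit_qopDr : right_distributive orbit_qop orbit_qop.
Proof. by move=> x y z; apply: orbit_inj; apply: qopDr. Qed.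

Lemma orbit_qop_unique (x y : qorbit e) : exists! u, orbit_qop x u = y.
Proof.
have [u [xu u_uniq]] := qop_unique (sval x) (sval y).
have ou : in_orbit e u.
  by apply: (@in_orbit_div (sval x)); rewrite xu; apply: svalP.
exists (exist _ u ou); split; first exact: orbit_inj.
by move=> v xv; apply: orbit_inj; apply: u_uniq; rewrite -xv.
Qed.

HB.instance Definition _ := isQuandle.Build (qorbit e)
  orbit_inhabited orbit_qopxx orbit_qopDr orbit_qop_unique.

End OrbitQuandle.

(* Main.v *)
Require Import Defs.
From HB Require Import structures.
From mathcomp Require Import all_boot.
From mathcomp Require Import boolp.

(** In a medial quandle the displacements L_a L_b^-1 generate an abelian group
    D, which has the same orbits as LMlt(Q).  Every element of D is an
    automorphism, so for al in D the commutator of al with L_y is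

      al L_y al^-1 L_y^-1 = L_(al y) L_y^-1,

    and because D is abelian it does not depend on y.  This defines an
    endomorphism delta of D, and delta al sends y to (al y) y.  Hence
    R_y^n (al y) = (delta^n al) y: on each orbit, powers of right translations
    are governed by one and the same endomorphism delta, and

    - the orbit of e is n-reductive iff delta^n al fixes e for every al in D
      ([orbit_reductiveP]).

    Since x y = (L_x L_y^-1) y and the L_x L_y^-1 with y fixed generate D, the
    same computation shows that Q is (n+1)-reductive iff delta^n D fixes every
    point, i.e. iff every orbit is n-reductive ([reductive_orbitsP]).

    If a single orbit, that of e, is n-reductive, then delta^n al fixes e, so
    it commutes with L_e and delta kills it: delta^(n+1) is trivial on all of
    D, whence every orbit is (n+1)-reductive and Q is (n+2)-reductive
    ([one_orbit_reductive]). *)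

(** * Left division *)

Section LeftDivision.
Set Implicit Arguments.
Unset Strict Implicit.
Local Open Scope quandle_scope.
Variable Q : quandleType.
Implicit Types x y z : Q.

Definition ldiv x y : Q := sval (cid (qop_unique x y)).

Lemma ldivK x : cancel (ldiv x) (qop x).
Proof. by move=> y; rewrite /ldiv; case: cid => u []. Qed.

Lemma qopK x : cancel (qop x) (ldiv x).
Proof.
move=> y; have [z [_ z_uniq]] := qop_unique x (x * y).
by rewrite -[RHS](z_uniq y) // -(z_uniq (ldiv x (x * y))) // ldivK.
Qed.

Lemma ldivxx x : ldiv x x = x.
Proof. by rewrite -{2}[x]qopxx qopK. Qed.

Lemma endo_ldiv (f : Q -> Q) : {morph f : x y / x * y} ->
  {morph f : x y / ldiv x y}.
Proof. by move=> fM x y; rewrite -[LHS](qopK (f x)) -fM ldivK. Qed.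

Lemma ldivM x y z : ldiv x (y * z) = ldiv x y * ldiv x z.
Proof. by rewrite -[RHS](qopK x) qopDr !ldivK. Qed.

End LeftDivision.

(** * The displacement group of a medial quandle *)

Section Displacements.
Set Implicit Arguments.
Unset Strict Implicit.
Local Open Scope quandle_scope.
Variable Q : quandleType.
Implicit Types (a b c d e x y z : Q) (al be : Q -> Q).

Definition disp a b : Q -> Q := fun z => a * ldiv b z.

(** A monoid presentation is enough to get a group, because the generators are
    closed under inversion ([dispK]). *)
Inductive Dis : (Q -> Q) -> Prop :=
| Dis_id : Dis id
| Dis_cons a b al : Dis al -> Dis (disp a b \o al).

Lemma disp_id a : disp a a = id.
Proof. by apply: funext => z; apply: ldivK. Qed.

Lemma disp_trans b a c : disp a b \o disp b c = disp a c.
Proof. by apply: funext => z; rewrite /disp /= qopK. Qed.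

Lemma dispK a b : cancel (disp a b) (disp b a).
Proof. by move=> z; rewrite /disp qopK ldivK. Qed.

Lemma disp_self a y : disp a y y = a * y.
Proof. by rewrite /disp ldivxx. Qed.

Lemma disp_morph a b : {morph disp a b : x y / x * y}.
Proof. by move=> x y; rewrite /disp ldivM qopDr. Qed.

Lemma Dis_disp a b : Dis (disp a b).
Proof. exact: (Dis_cons a b Dis_id). Qed.

Lemma Dis_comp al be : Dis al -> Dis be -> Dis (al \o be).
Proof.
move=> Dal Dbe; elim: Dal => [|a b ga _ IH]; first exact: Dbe.
exact: (Dis_cons a b IH).
Qed.

Lemma Dis_inv al : Dis al -> exists be, [/\ Dis be, cancel al be & cancel be al].
Proof.
elim=> [|a b ga _ [be [Dbe gaK beK]]]; first by exists id; split=> //; exact: Dis_id.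
exists (be \o disp b a); split.
- exact/Dis_comp/Dis_disp.
- by move=> z /=; rewrite dispK gaK.
- by move=> z /=; rewrite beK dispK.
Qed.

Lemma Dis_morph al : Dis al -> {morph al : x y / x * y}.
Proof.
by elim=> [//|a b ga _ IH] x y /=; rewrite IH disp_morph.
Qed.

Lemma Dis_in_orbit e al : Dis al -> Defs.in_orbit e (al e).
Proof.
elim=> [|a b ga _ IH] /=; first exact: in_orbit_refl.
by apply/in_orbit_mul/(@in_orbit_div _ _ b); rewrite ldivK.
Qed.

(** D has the orbits of LMlt(Q) because L_a x = (L_a L_x^-1) x: at a given
    point, L_a acts as a displacement that depends on the point. *)
Lemma LMlt_Dis (f : Q -> Q) : LMlt f -> forall x, exists2 al, Dis al & f x = al x.
Proof.
elim=> [x|a x|f1 f2 _ IH1 _ IH2 x|f1 f2 _ IH _ f2K x].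
- by exists id => //; exact: Dis_id.
- by exists (disp a x); [exact: Dis_disp | rewrite disp_self].
- have [be Dbe fx] := IH2 x; have [al Dal ffx] := IH1 (f2 x).
  by exists (al \o be); [exact: Dis_comp | rewrite /= ffx fx].
- have [al Dal] := IH (f2 x); have [be [Dbe alK _]] := Dis_inv Dal.
  by rewrite f2K => xE; exists be; rewrite // [in RHS]xE alK.
Qed.

Lemma in_orbitP e x : Defs.in_orbit e x <-> exists2 al, Dis al & al e = x.
Proof.
split=> [[f Lf <-]|[al Dal <-]]; last exact: Dis_in_orbit.
by have [al Dal ->] := LMlt_Dis Lf e; exists al.
Qed.

(** * The endomorphism delta and right translations *)

(** The commutator al L_y al^-1 L_y^-1, written without al^-1 by means of
    al L_y al^-1 = L_(al y). *)
Definition delta y al : Q -> Q := disp (al y) y.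

Lemma Dis_delta y al : Dis (delta y al).
Proof. exact: Dis_disp. Qed.

Lemma Dis_iter_delta n y al : Dis al -> Dis (iter n (delta y) al).
Proof. by case: n => // n _; apply: Dis_delta. Qed.

Lemma delta_id y : delta y id = id.
Proof. exact: disp_id. Qed.

Lemma iter_delta_id n y : iter n (delta y) id = id.
Proof. by elim: n => //= n ->; rewrite delta_id. Qed.

(** Since L_y fixes y, (al y) y = L_(al y) (L_y^-1 y) = (delta al) y. *)
Lemma iter_rtrans n y al : iter n (rtrans y) (al y) = iter n (delta y) al y.
Proof. by elim: n => //= n ->; rewrite /delta disp_self. Qed.

Hypothesis Qmedial : medial Q.

(** This is the law (ur)(pq) = (up)(rq) with ur = a, up = c and uq = z, where
    u = b. *)
Lemma ldiv_swap a b c z : a * ldiv b (c * z) = c * ldiv b (a * z).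
Proof. by rewrite !ldivM -{1}(ldivK b a) Qmedial ldivK. Qed.

Lemma disp_comm a b c d z : disp a b (disp c d z) = disp c d (disp a b z).
Proof.
rewrite /disp -(ldivK d z) qopK.
(* Both sides equal c (b \ (a (d \ z))). *)
by rewrite ldiv_swap [a * _ in RHS]ldiv_swap qopK.
Qed.

Lemma Dis_disp_comm a b al z : Dis al -> disp a b (al z) = al (disp a b z).
Proof.
by elim=> [//|c d ga _ IH] /=; rewrite disp_comm IH.
Qed.

Lemma Dis_comm al be z : Dis al -> Dis be -> al (be z) = be (al z).
Proof.
by move=> + Dbe; elim=> [//|a b ga _ IH] /=; rewrite IH Dis_disp_comm.
Qed.

(** The conjugate of L_x L_y^-1 by al is L_(al x) L_(al y)^-1, so in an abelian
    group the two displacements agree. *)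
Lemma disp_Dis al x y : Dis al -> disp (al x) (al y) = disp x y.
Proof.
move=> Dal; have [be [_ _ beK]] := Dis_inv Dal; apply: funext => z.
rewrite -[z]beK; have alM := Dis_morph Dal.
by rewrite /disp -(endo_ldiv alM) -alM -Dis_disp_comm.
Qed.

(** L_(al x) L_x^-1 is the product of L_(al x) L_(al y)^-1, which equals
    L_x L_y^-1, and L_(al y) L_x^-1; in the other order these two factors
    compose to L_(al y) L_y^-1. *)
Lemma delta_base x y al : Dis al -> delta x al = delta y al.
Proof.
move=> Dal; rewrite /delta -(disp_trans (al y)) disp_Dis //.
by apply: funext => z; rewrite /= disp_comm -[LHS]/((_ \o _) z) disp_trans.
Qed.

Lemma iter_delta_base n x y al : Dis al ->
  iter n (delta x) al = iter n (delta y) al.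
Proof.
move=> Dal; elim: n => //= n ->.
exact/delta_base/Dis_iter_delta.
Qed.

(** L_(al be y) L_y^-1 = (L_(al be y) L_(be y)^-1) (L_(be y) L_y^-1), and the
    first factor is delta al computed at the base point be y. *)
Lemma delta_comp y al be : Dis al ->
  delta y (al \o be) = delta y al \o delta y be.
Proof.
move=> Dal; rewrite (delta_base y (be y) Dal) /delta; exact/esym/disp_trans.
Qed.

Lemma iter_delta_comp n y al be : Dis al -> Dis be ->
  iter n (delta y) (al \o be) = iter n (delta y) al \o iter n (delta y) be.
Proof.
move=> Dal Dbe; elim: n => //= n ->.
exact/delta_comp/Dis_iter_delta.
Qed.

(** * Reductivity in terms of delta *)

Lemma sval_iter_rtrans n e (x y : qorbit e) :
  sval (iter n (rtrans y) x) = iter n (rtrans (sval y)) (sval x).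
Proof. by elim: n => //= n ->. Qed.

Lemma orbit_reductiveP n e :
  m_reductive (qorbit e) n <-> forall al, Dis al -> iter n (delta e) al e = e.
Proof.
split=> [red al Dal|fix_e x y].
  pose x : qorbit e := exist _ (al e) (Dis_in_orbit e Dal).
  pose y : qorbit e := exist _ e (in_orbit_refl e).
  by have := congr1 sval (red x y); rewrite sval_iter_rtrans /= iter_rtrans.
apply: orbit_inj; rewrite sval_iter_rtrans.
have [al Dal <-] := (in_orbitP e (sval x)).1 (svalP x).
have [be Dbe <-] := (in_orbitP e (sval y)).1 (svalP y).
have [be' [Dbe' beK _]] := Dis_inv Dbe.
(* Write x = (al be^-1) y with y = be e; as be commutes with D, what fixes e
   also fixes y. *)
have Dga : Dis (al \o be') := Dis_comp Dal Dbe'.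
rewrite -[in al e](beK e) -[al _]/((al \o be') (be e)) iter_rtrans.
rewrite (iter_delta_base _ _ e) // Dis_comm ?fix_e //.
exact: Dis_iter_delta.
Qed.

(** For fixed y the displacements L_x L_y^-1 generate D, and x y is the image of
    y under L_x L_y^-1, so (n+1)-reductivity says that delta^n of each of these generators fixes
    y. *)
Lemma reductive_orbitsP n :
  m_reductive Q n.+1 <-> forall e, m_reductive (qorbit e) n.
Proof.
split=> [red e|red x y].
  have fix_gen x y : iter n (delta y) (disp x y) y = y.
    by rewrite -iter_rtrans disp_self -iterSr red.
  apply/orbit_reductiveP => al; elim=> [|a b ga Dga IH].
    by rewrite iter_delta_id.
  have Dd := Dis_disp; rewrite iter_delta_comp //= IH.
  rewrite -(disp_trans e) iter_delta_comp //=.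
  (* L_e L_b^-1 is the inverse of a generator, so its image under delta^n is
     the inverse of a map that fixes e. *)
  have: iter n (delta e) (disp e b \o disp b e) e = e.
    by rewrite disp_trans disp_id iter_delta_id.
  by rewrite iter_delta_comp //= fix_gen => ->; apply: fix_gen.
rewrite iterSr -[rtrans y x]disp_self iter_rtrans.
by have /orbit_reductiveP := red y; apply; apply: Dis_disp.
Qed.

(** An element of D that fixes e commutes with L_e, so it is killed by delta;
    hence one more application of delta turns a fixed point at e into the
    identity everywhere. *)
Lemma one_orbit_reductive n e :
  m_reductive (qorbit e) n -> m_reductive Q n.+2.
Proof.
move=> /orbit_reductiveP fix_e; apply/reductive_orbitsP => y.
apply/orbit_reductiveP => al Dal.
by rewrite (iter_delta_base _ _ e) //= /delta -/(delta e) fix_e // disp_id.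
Qed.

Lemma m_reductive_leq m n : m <= n -> m_reductive Q m -> m_reductive Q n.
Proof.
move=> /subnK <- red x y; rewrite iterD red.
by elim: (n - m) => //= k ->; exact: qopxx.
Qed.

End Displacements.

Theorem theorem6p6 (Q : quandleType) (hQ : medial Q) :
  ((reductive Q <-> exists e : Q, reductive (qorbit e)) /\
   (reductive Q <-> forall e : Q, reductive (qorbit e))) /\
  (forall m : nat, 1 <= m ->
    (m_reductive Q m <-> forall e : Q, m_reductive (qorbit e) (m - 1)) /\
    ((exists e : Q, m_reductive (qorbit e) m) -> m_reductive Q (m + 3))).
Proof.
have [e0] := @quandle_inhabited Q.
have all_orbits : reductive Q -> forall e : Q, reductive (qorbit e).
  move=> [m red] e; exists m; apply: (reductive_orbitsP hQ m).1.
  exact: m_reductive_leq (leqnSn m) red.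
have some_orbit (e : Q) : reductive (qorbit e) -> reductive Q.
  by move=> [m red]; exists m.+2; apply: (one_orbit_reductive hQ red).
split; first split; first split.
- by move=> /all_orbits red; exists e0.
- by move=> [e /some_orbit].
- by split=> [/all_orbits //|/(_ e0)/some_orbit].
- case=> // n _; rewrite subn1; split; first exact: (reductive_orbitsP hQ).
  case=> e /(one_orbit_reductive hQ); apply: m_reductive_leq.
  by rewrite addn3.
Qed.
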